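(* Let $k>3$ be a parameter known to all nodes. There is a distributed algorithm in the \textsc{Beeping} model that solves \textsc{SetCover} in time $O(k^3)$ with approximation ratio $O\left(\log^2(\Delta)\cdot \left(\Delta^{1/k}\right)^3\right)$.
   Context: \textsc{SetCover}: given a ground set $\mathcal{U}$ of elements and a family $\mathcal{S}$ of subsets of $\mathcal{U}$, find a minimum number of sets from $\mathcal{S}$ whose union is $\mathcal{U}$. The approximation ratio compares the size of the output cover with the size $|S_{OPT}|$ of an optimal cover. Problem/communication graph: $G=(V_{\mathcal{S}}\cup V_{\mathcal{U}},E)$, with one node per set and one node per element, and a bidirected edge $\{s,e\}$ whenever set $s$ contains element $e$. Nodes communicate only with their neighbors in $G$. $\Delta$ is the maximum degree of $G$ and is known to all nodes. Nodes do not know their exact degree and have no identifiers. \textsc{Beeping} model: time proceeds in synchronized slots, and all nodes wake up in the same slot. In each slot a node either beeps or listens, not both. A listening node receives a beep if and only if at least one of its neighbors beeps in that slot. It cannot tell which neighbors beeped or how many did. *)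

(* Defs.v *)
From Stdlib Require Import Reals.
From mathcomp Require Import all_boot all_order all_algebra.
From mathcomp Require Import Rstruct.

Set Implicit Arguments.
Unset Strict Implicit.
Unset Printing Implicit Defensive.

Import Order.TTheory GRing.Theory Num.Theory.

(* Nodes of G: one per set (inl) and one per element (inr). *)
Definition node (S U : finType) := (S + U)%type.

Definition adj (S U : finType) (mem : S -> U -> bool) : rel (node S U) :=
  fun v w => match v, w with
             | inl s, inr u => mem s u
             | inr u, inl s => mem s u
             | _, _ => false
             end.

Definition deg (S U : finType) (mem : S -> U -> bool) (v : node S U) : nat :=
  #|[set w | adj mem v w]|.

Definition maxdeg (S U : finType) (mem : S -> U -> bool) : nat :=
  \max_(v : node S U) deg mem v.

Definition is_cover (S U : finType) (mem : S -> U -> bool) (C : {set S}) : Prop :=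
  forall u : U, exists2 s, s \in C & mem s u.

Definition is_min_cover (S U : finType) (mem : S -> U -> bool) (C : {set S}) : Prop :=
  is_cover mem C /\ forall C' : {set S}, is_cover mem C' -> (#|C| <= #|C'|)%N.

(* A (uniform, anonymous) beeping algorithm.  All nodes run the same
   program; a node only knows whether it is a set node or an element node
   (and the global parameters, on which the whole algorithm may depend).
   In every slot each node draws a fresh independent random coin from the
   finite distribution [coin_dist]; depending on its state and coin it
   beeps or listens; a listening node learns whether at least one
   neighbour beeped.  After [rounds] slots a set node outputs [out]. *)
Record beep_alg := BeepAlg {
  State : Type;
  Coin : finType;
  coin_dist : Coin -> R;
  coin_dist_ge0 : forall c, (0 <= coin_dist c)%R;
  coin_dist_sum1 : (\sum_(c : Coin) coin_dist c = 1)%R;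
  init_set : State;
  init_elem : State;
  beeps : State -> Coin -> bool;
  update : State -> Coin -> bool -> State; (* bool = "heard a beep"
                                               (false when the node beeped) *)
  out : State -> bool;
  rounds : nat
}.

Section Execution.
Variables (A : beep_alg) (S U : finType) (mem : S -> U -> bool).

Definition init_conf : node S U -> State A :=
  fun v => match v with inl _ => init_set A | inr _ => init_elem A end.

Definition step (cfg : node S U -> State A) (c : node S U -> Coin A)
  : node S U -> State A :=
  fun v =>
    let b := beeps (cfg v) (c v) in
    update (cfg v) (c v)
      (~~ b && [exists w, adj mem v w && beeps (cfg w) (c w)]).

Definition outcome := {ffun 'I_(rounds A) -> {ffun node S U -> Coin A}}.

Definition final_conf (om : outcome) : node S U -> State A :=
  foldl (fun cfg i => step cfg (om i)) init_conf (enum 'I_(rounds A)).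

Definition output (om : outcome) : {set S} :=
  [set s | out (final_conf om (inl s))].

Definition prob (om : outcome) : R :=
  (\prod_(i : 'I_(rounds A)) \prod_(v : node S U) coin_dist (om i v))%R.

Definition expected_size : R :=
  (\sum_(om : outcome) prob om * (#|output om|)%:R)%R.

Definition always_covers : Prop :=
  forall om : outcome, (0 < prob om)%R -> is_cover mem (output om).

End Execution.

(* Main.v *)
(* Let b be about Delta^(1/K) with K at most k and O(log Delta).  Phase i works
   with the probability q = b^(i-K), i = 0..K, and runs through levels j = 0..K
   with p = b^(j-K), two slots per level.  All sets are candidates when a phase
   starts.  In the first slot every uncovered element beeps with probability q,
   and the candidates that hear nothing drop out for the rest of the phase; in
   the second slot every candidate joins with probability p and beeps, which
   covers its elements.

   Cost of a phase.  A candidate with x uncovered elements survives a first slot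
   with probability at most q x, so the joins of a level can be charged to the
   uncovered elements, an element in f candidates paying q p f.  It then remains
   uncovered with probability (1 - p)^f, and (1 + p f) (1 - p)^f <= 1 makes
   q (p f + b) a supermartingale bound for all that an element pays in a phase.

   Progress.  A set with x uncovered elements, q x > 3 ln Delta, drops out in a
   given level with probability at most Delta^-3, while a set that never drops
   out joins at the last level, where p = 1.  Hence after the phase each set of
   an optimal cover has, up to a negligible expected excess, at most
   3 ln(Delta)/q uncovered elements, and the next phase, at probability b q,
   costs O(b^2 ln Delta) per optimal set.  In phase K all uncovered elements
   beep, no set with an uncovered element drops out, and everything gets
   covered. *)

Require Import Defs.
From Stdlib Require Import Reals FunctionalExtensionality.
From mathcomp Require Import all_boot all_order all_algebra.
From mathcomp Require Import Rstruct.
From mathcomp Require Import lra zify ring.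
Import Order.TTheory GRing.Theory Num.Theory.

Set Implicit Arguments.
Unset Strict Implicit.
Unset Printing Implicit Defensive.

Local Open Scope ring_scope.

(** * Expectations over independent coins *)

(** [inv n a] describes a state with [n] steps still to run, so [W] has to decrease in expectation
    only before the clock runs out. The induction splits off the first coin. *)
Lemma supermartingale_bound (R : realFieldType) (X : finType) (T : Type) (w : X -> R)
    (g : T -> X -> T) (W : T -> R) (inv : nat -> T -> Prop) :
  (forall x, 0 <= w x) ->
  (forall n a x, inv n.+1 a -> inv n (g a x)) ->
  (forall n a, inv n.+1 a -> \sum_x w x * W (g a x) <= W a) ->
  forall n a, inv n a ->
    \sum_(om : {ffun 'I_n -> X})
       (\prod_i w (om i)) *
       W (foldl (fun a i => g a (om i)) a (enum 'I_n)) <= W a.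
Proof.
move=> w_ge0 invS decW; elim=> [|n IHn] a inv_a.
  have [|om0 all0] := fintype1 (T := {ffun 'I_0 -> X}) _.
    by rewrite card_ffun card_ord expn0.
  rewrite (big_pred1 om0) => [|om]; last by rewrite /= [om]all0 eqxx.
  by rewrite big_ord0 mul1r enum_ord0.
pose h (p : X * {ffun 'I_n -> X}) : {ffun 'I_n.+1 -> X} :=
  [ffun i => oapp p.2 p.1 (unlift ord0 i)].
have h0 p : h p ord0 = p.1 by rewrite ffunE unlift_none.
have hS p i : h p (lift ord0 i) = p.2 i by rewrite ffunE liftK.
have h_bij : bijective h.
  exists (fun om : {ffun _ -> X} => (om ord0, [ffun i : 'I_n => om (lift ord0 i)])) => [[x om]|om].
    by rewrite h0; congr pair; apply/ffunP=> i; rewrite ffunE hS.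
  apply/ffunP=> i; case: (unliftP ord0 i) => [j|] ->; rewrite ?h0 // hS.
  by rewrite /= ffunE.
rewrite (reindex h) /=; last exact: onW_bij.
rewrite -(pair_bigA _ (fun x om => (\prod_i w (h (x, om) i)) *
   W (foldl (fun a i => g a (h (x, om) i)) a (enum 'I_n.+1)))) /=.
apply: le_trans (decW _ _ inv_a); apply: ler_sum => x _.
apply: le_trans (ler_wpM2l (w_ge0 x) (IHn _ (invS _ _ x inv_a))).
rewrite mulr_sumr; apply: ler_sum => om _.
rewrite big_ord_recl h0 -mulrA; apply: ler_wpM2l => //=.
rewrite enum_ordSl /= h0 /=.
rewrite (eq_bigr (fun i => w (om i))) => [|i _]; last by rewrite hS.
rewrite le_eqVlt; apply/orP; left; apply/eqP; congr (_ * W _).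
elim: (enum 'I_n) (g a x) => //= i l IHl a'; rewrite hS; exact: IHl.
Qed.

Lemma trajectory_inv (X : finType) (T : Type) (I : Type) (g : T -> X -> T)
    (inv : T -> Prop) (om : I -> X) (l : seq I) a :
  (forall a x, inv a -> inv (g a x)) ->
  inv a -> inv (foldl (fun a i => g a (om i)) a l).
Proof. by move=> invS; elim: l a => //= i l IHl a inv_a; apply/IHl/invS. Qed.

Section Coins.
Variables (R : realFieldType) (K : nat) (b : R).
Hypothesis b_ge1 : 1 <= b.

(** The power b^(i-K). At i = K+1, reached after the last phase, it equals b and need not be a
    probability. *)
Definition rate (i : nat) : R := b ^+ i / b ^+ K.

Let b_gt0 : 0 < b. Proof. exact: lt_le_trans ltr01 b_ge1. Qed.

Lemma rate_ge0 i : 0 <= rate i.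
Proof. by rewrite divr_ge0 // exprn_ge0 // ltW. Qed.

Lemma rateS i : rate i.+1 = b * rate i.
Proof. by rewrite /rate exprS mulrA. Qed.

Lemma rate_max : rate K = 1.
Proof. by rewrite /rate divff // expf_neq0 // gt_eqF. Qed.

Lemma rate_le1 i : (i <= K)%N -> rate i <= 1.
Proof.
by move=> leiK; rewrite ler_pdivrMr ?exprn_gt0 // mul1r ler_weXn2l.
Qed.

Definition below_rate (n : nat) : R := if n is i.+1 then rate i else 0.

(* A coin shows a value at most [i] with probability [rate i], so the same
   coin serves for all the probabilities used by the algorithm. *)
Definition coin_weight (c : 'I_K.+1) : R := below_rate c.+1 - below_rate c.

Lemma coin_weight_ge0 c : 0 <= coin_weight c.
Proof.
rewrite /coin_weight; case: c => -[|i] ltiK /=.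
  by rewrite subr0 rate_ge0.
by rewrite subr_ge0 rateS ler_peMl // rate_ge0.
Qed.

Lemma coin_weight_above j : (j <= K)%N ->
  \sum_(c : 'I_K.+1 | (j <= c)%N) coin_weight c = 1 - below_rate j.
Proof.
move=> lejK; rewrite -rate_max.
rewrite -(big_mkord (fun c => (j <= c)%N)
  (fun c => below_rate c.+1 - below_rate c)).
rewrite (big_cat_nat (n := j)) //=; last by rewrite ltnW.
rewrite big_nat_cond big_pred0 ?add0r => [|i]; last lia.
rewrite big_nat_cond (eq_bigl (fun i => (j <= i < K.+1)%N)) => [|i]; last lia.
by rewrite -big_nat (telescope_sumr below_rate) // ltnW.
Qed.

Lemma coin_weight_sum1 : \sum_c coin_weight c = 1.
Proof. by have := coin_weight_above (leq0n K); rewrite subr0. Qed.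

Section Expectation.
Variable V : finType.
Implicit Types (X Y : {ffun V -> 'I_K.+1} -> R) (A : {set V}).

Definition weight (c : {ffun V -> 'I_K.+1}) : R := \prod_v coin_weight (c v).

Definition expect X : R := \sum_c weight c * X c.

Lemma weight_ge0 c : 0 <= weight c.
Proof. by apply: prodr_ge0 => v _; apply: coin_weight_ge0. Qed.

Lemma expect_cst a : expect (fun=> a) = a.
Proof.
rewrite /expect -mulr_suml -(bigA_distr_bigA (fun _ => coin_weight)) /=.
by rewrite big1 ?mul1r // => v _; apply: coin_weight_sum1.
Qed.

Lemma expectD X Y : expect (fun c => X c + Y c) = expect X + expect Y.
Proof. by rewrite /expect -big_split; apply: eq_bigr => c _; rewrite mulrDr. Qed.

Lemma expectZ a X : expect (fun c => a * X c) = a * expect X.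
Proof.
by rewrite /expect mulr_sumr; apply: eq_bigr => c _; rewrite mulrCA.
Qed.

Lemma expect_sum (I : finType) (P : pred I) (F : I -> {ffun V -> 'I_K.+1} -> R) :
  expect (fun c => \sum_(i | P i) F i c) = \sum_(i | P i) expect (F i).
Proof.
by rewrite /expect exchange_big; apply: eq_bigr => c _; rewrite mulr_sumr.
Qed.

Lemma ler_expect X Y : (forall c, X c <= Y c) -> expect X <= expect Y.
Proof.
by move=> leXY; apply: ler_sum => c _; apply/ler_wpM2l/leXY/weight_ge0.
Qed.

Lemma eq_expect X Y : X =1 Y -> expect X = expect Y.
Proof. by move=> eqXY; apply: eq_bigr => c _; rewrite eqXY. Qed.

(** Independence: the indicator is a product over the nodes, and a node outside [A] contributes the
    total weight 1. *)
Lemma expect_all_above A j : (j <= K)%N ->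
  expect (fun c => [forall v in A, (j < c v)%N]%:R) = (1 - rate j) ^+ #|A|.
Proof.
move=> lejK.
have P1 : \sum_(c : 'I_K.+1 | (j < c)%N) coin_weight c = 1 - rate j.
  case: (ltnP j K) => [ltjK|leKj]; first exact: (coin_weight_above ltjK).
  have -> : j = K by lia.
  by rewrite rate_max subrr big_pred0 // => c; have := ltn_ord c; lia.
pose Fv v (c : 'I_K.+1) := coin_weight c * ((v \in A) ==> (j < c)%N)%:R.
transitivity (\sum_(c : {ffun V -> 'I_K.+1}) \prod_v Fv v (c v)).
  apply: eq_bigr => c _; rewrite /Fv big_split /=; congr (_ * _).
  case: forallP => [allc|nallc].
    by rewrite big1 // => v _; rewrite allc.
  apply/esym/eqP; rewrite prodf_seq_eq0; apply/hasP.
  have /forallPn[v Nv] : ~~ [forall v, (v \in A) ==> (j < c v)%N].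
    by apply/negP => /forallP.
  by exists v; rewrite ?mem_index_enum // (negPf Nv) eqxx.
rewrite -(bigA_distr_bigA Fv) /= -prodr_const.
rewrite [RHS]big_mkcond /=; apply: eq_bigr => v _.
rewrite /Fv; case: ifP => Av.
  rewrite -P1 [RHS]big_mkcond; apply: eq_bigr => c _.
  by case: ifP; rewrite ?mulr1 ?mulr0.
by rewrite -[RHS]coin_weight_sum1; apply: eq_bigr => c _; rewrite mulr1.
Qed.

Lemma expect_below v j : (j <= K)%N ->
  expect (fun c => (c v <= j)%N%:R) = rate j.
Proof.
move=> lejK; have := expect_all_above [set v] lejK.
rewrite cards1 expr1 => /(congr1 (fun x => 1 - x)); rewrite subKr => <-.
rewrite -[X in X - _](expect_cst 1) -mulN1r -expectZ -expectD.
apply: eq_expect => c; have -> : [forall w in [set v], (j < c w)%N] = (j < c v)%N.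
  apply/forall_inP/idP => [->//|ltj w /set1P->//]; exact: set11.
by rewrite ltnNge; case: (c v <= j)%N => /=; lra.
Qed.

End Expectation.
End Coins.

(** * The algorithm *)

(** [joining] marks the second slot of a level. *)
Record clock := Clock { phase : nat; level : nat; joining : bool }.

Definition tick (K : nat) (t : clock) : clock :=
  if joining t then
    if level t == K then Clock (phase t).+1 0 false
    else Clock (phase t) (level t).+1 false
  else Clock (phase t) (level t) true.

(* [finished] means "has joined the cover" for a set and "is covered" for an
   element. *)
Record node_state := NodeState {
  time : clock; is_set : bool; candidate : bool; finished : bool }.

Definition node_beeps (K : nat) (x : node_state) (c : 'I_K.+1) : bool :=
  if is_set x then [&& joining (time x), candidate x & c <= level (time x)]%N
  else [&& ~~ joining (time x), ~~ finished x & c <= phase (time x)]%N.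

(** The test for level 0 makes every set a candidate again when a phase starts. *)
Definition node_update (K : nat) (x : node_state) (c : 'I_K.+1) (heard : bool) :=
  NodeState (tick K (time x)) (is_set x)
    (if joining (time x) then candidate x
     else [&& is_set x, heard & (level (time x) == 0%N) || candidate x])
    (finished x ||
     joining (time x) && (if is_set x then node_beeps x c else heard)).

Definition cover_alg (K : nat) (b : R) (b_ge1 : 1 <= b) : beep_alg :=
  @BeepAlg node_state 'I_K.+1 (coin_weight b)
    (coin_weight_ge0 b_ge1) (coin_weight_sum1 K b_ge1)
    (NodeState (Clock 0 0 false) true false false)
    (NodeState (Clock 0 0 false) false false false)
    (@node_beeps K) (@node_update K) finished (2 * (K.+1 * K.+1)).

(** * Global view of a run, and correctness of the cover *)

Section GlobalRun.
Variables (K : nat) (S U : finType) (mem : S -> U -> bool).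

Record global := Global {
  now : clock; cands : {set S}; joined : {set S}; uncov : {set U} }.

Implicit Types (g : global) (c : {ffun node S U -> 'I_K.+1}).

Definition eligible g : {set S} :=
  if (level (now g) == 0%N) && ~~ joining (now g) then setT else cands g.

Definition hearing g c : {set S} :=
  [set s in eligible g |
    [exists u in uncov g, mem s u && (c (inr u) <= phase (now g))%N]].

Definition entering g c : {set S} :=
  [set s in cands g | (c (inl s) <= level (now g))%N].

Definition missed g c : {set U} :=
  [set u in uncov g | [forall s in cands g,
                         mem s u ==> (level (now g) < c (inl s))%N]].

Definition gstep g c : global :=
  if joining (now g) then
    Global (tick K (now g)) (cands g) (joined g :|: entering g c) (missed g c)
  else Global (tick K (now g)) (hearing g c) (joined g) (uncov g).

Definition ginit : global := Global (Clock 0 0 false) set0 set0 setT.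

Definition encode g (v : node S U) : node_state :=
  match v with
  | inl s => NodeState (now g) true (s \in cands g) (s \in joined g)
  | inr u => NodeState (now g) false false (u \notin uncov g)
  end.

(** In each slot only one side of the bipartite graph beeps, so the listening side misses nothing by
    the rule that a beeping node hears nothing. *)
Lemma step_encode (b : R) (b_ge1 : 1 <= b) g c :
  step (A := cover_alg K b_ge1) mem (encode g) c = encode (gstep g c).
Proof.
apply: functional_extensionality => -[s|u]; rewrite /step /encode /=.
  case: g => -[i j []] C J N; rewrite /gstep /node_beeps /node_update /=.
    congr NodeState; rewrite !inE //=.
  congr NodeState; rewrite ?orbF // !inE /eligible /= andbT andbC.
  congr (_ && _); first by case: eqP => _; rewrite ?inE.
  apply/existsP/existsP => -[].
    by move=> [s'|u]//= /and3P[smu /negPn Nu cu]; exists u; rewrite Nu smu.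
  by move=> u /and3P[Nu smu cu]; exists (inr u); rewrite /= smu Nu.
case: g => -[i j []] C J N; rewrite /gstep /node_beeps /node_update /=;
  last by congr NodeState; rewrite ?orbF.
congr NodeState; rewrite !inE negb_and; congr (_ || _).
apply/existsP/forallPn => -[].
  by move=> [s|u']//= /and3P[smu Cs cs]; exists s; rewrite Cs smu -leqNgt.
move=> s; rewrite !negb_imply -leqNgt => /and3P[Cs smu cs].
by exists (inl s); rewrite /= smu Cs.
Qed.

Definition grun n (om : {ffun 'I_n -> {ffun node S U -> 'I_K.+1}}) : global :=
  foldl (fun g i => gstep g (om i)) ginit (enum 'I_n).

Lemma output_grun (b : R) (b_ge1 : 1 <= b)
    (om : outcome (cover_alg K b_ge1) S U) :
  output mem om = joined (grun om).
Proof.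
apply/setP=> s; rewrite inE /output /final_conf /grun.
have -> : @init_conf (cover_alg K b_ge1) S U = encode ginit.
  by apply: functional_extensionality => -[s'|u] /=; rewrite ?inE.
have -> : forall l g,
    foldl (fun cfg i => step (A := cover_alg K b_ge1) mem cfg (om i)) (encode g) l
      = encode (foldl (fun g i => gstep g (om i)) g l).
  by elim=> //= i l IHl g; rewrite step_encode IHl.
by [].
Qed.

Definition slot (t : clock) : nat :=
  (2 * (phase t * K.+1 + level t) + joining t)%N.

Lemma slot_tick t : slot (tick K t) = (slot t).+1.
Proof.
case: t => i j [] /=; rewrite /slot /tick /=; last lia.
by case: eqP => /= [->|_]; lia.
Qed.

Lemma now_gstep g c : now (gstep g c) = tick K (now g).
Proof. by rewrite /gstep; case: ifP. Qed.

Lemma level_tick t : (level t <= K)%N -> (level (tick K t) <= K)%N.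
Proof. by case: t => i j [] //=; rewrite /tick /=; case: eqP => //=; lia. Qed.

(* In phase [K] the uncovered elements beep with certainty. *)
Definition covering_inv g : Prop :=
  [/\ (level (now g) <= K)%N,
      forall u, u \notin uncov g -> exists2 s, s \in joined g & mem s u,
      phase (now g) = K ->
        forall s u, mem s u -> u \in uncov g -> s \in eligible g
    & (K < phase (now g))%N -> uncov g = set0].

Lemma covering_inv_gstep g c :
  (forall u, exists s, mem s u) -> covering_inv g -> covering_inv (gstep g c).
Proof.
move=> cov [lejK Hcov Helig Hlast].
have c_le v : (c v <= K)%N by rewrite -ltnS ltn_ord.
split; first by rewrite now_gstep level_tick.
- case: g lejK Hcov {Helig Hlast} => -[i j []] C J N /= lejK Hcov u //=;
    rewrite /gstep /=; last exact: Hcov.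
  rewrite inE negb_and => /orP[/Hcov[s Js smu]|].
    by exists s; rewrite // inE Js.
  case/forallPn=> s; rewrite !negb_imply -leqNgt => /and3P[Cs smu cs].
  by exists s; rewrite // !inE Cs cs orbT.
- case: g lejK Helig {Hcov Hlast} => -[i j []] C J N /= lejK Helig;
    rewrite /gstep /tick /=.
    rewrite /eligible /=; case: (j =P K) => [//|_] /= iK s u smu.
    by rewrite inE => /andP[Nu _]; have := Helig iK s u smu Nu; rewrite /eligible andbF.
  move=> iK s u smu Nu; rewrite /eligible /= andbF inE (Helig iK s u) //=.
  by apply/existsP; exists u; rewrite Nu smu /= iK c_le.
- case: g lejK Helig Hlast {Hcov} => -[i j []] C J N /= lejK Helig Hlast;
    rewrite /gstep /tick /=; last exact: Hlast.
  have sub0 : (K < i)%N -> missed (Global (Clock i j true) C J N) c = set0.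
    by move=> /Hlast N0; apply/setP=> u; rewrite !inE N0 inE.
  case: (j =P K) => [jK|_] //= ltKi; case: (ltnP K i) => [/sub0//|leiK].
  have iK : i = K by lia.
  apply/setP=> u; rewrite !inE; apply/negP => /andP[Nu /forallP miss].
  (* Some set containing [u] is still a candidate, and at level K every candidate joins because no
     coin exceeds K. *)
  have [s smu] := cov u; have Cs := Helig iK s u smu Nu.
  move: Cs; rewrite /eligible andbF /= => Cs.
  by have := miss s; rewrite Cs smu /= jK ltnNge c_le.
Qed.

Lemma covers_grun (om : {ffun 'I_(2 * (K.+1 * K.+1)) -> {ffun node S U -> 'I_K.+1}}) :
  (forall u, exists s, mem s u) -> is_cover mem (joined (grun om)).
Proof.
move=> cov.
have inv0 : covering_inv ginit.
  by split=> //= u; rewrite inE.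
have [lejK Hcov _ Hlast] : covering_inv (grun om).
  by apply: trajectory_inv inv0 => g c; apply: covering_inv_gstep.
have slot_end : slot (now (grun om)) = (2 * (K.+1 * K.+1))%N.
  rewrite -[RHS](size_enum_ord) -[RHS]add0n -[X in (X + _)%N]/(slot (now ginit)).
  rewrite /grun; elim: (enum _) ginit => [|i l IHl] g /=; first by rewrite addn0.
  by rewrite IHl now_gstep slot_tick addSnnS.
have N0 : uncov (grun om) = set0.
  apply: Hlast; rewrite ltnNge; apply/negP => leiK.
  move: slot_end lejK leiK; rewrite /slot.
  by case: (joining _) => /=; nia.
by move=> u; apply: Hcov; rewrite N0 inE.
Qed.

End GlobalRun.

(** * The potential *)

Lemma sum_sep (R : pzSemiRingType) (T : finType) (A : {set T}) (P : pred T)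
    (F : T -> R) :
  \sum_(x in [set x in A | P x]) F x = \sum_(x in A) F x * (P x)%:R.
Proof.
rewrite [RHS](bigID P) /= [X in _ + X]big1 ?addr0.
  rewrite (eq_bigl (fun x => (x \in A) && P x)) => [|x]; last by rewrite inE.
  by apply: eq_bigr => x /andP[_ ->]; rewrite mulr1.
by move=> x /andP[_ /negPf->]; rewrite mulr0.
Qed.

Lemma natr_card_sep (R : pzSemiRingType) (T : finType) (A : {set T}) (P : pred T) :
  #|[set x in A | P x]|%:R = \sum_(x in A) (P x)%:R :> R.
Proof.
rewrite -sum1_card natr_sum sum_sep.
by apply: eq_bigr => x _; rewrite mul1r.
Qed.

(** Induction step: (1 - p)(1 + p(n+1)) = 1 + pn - p^2 (n+1). *)
Lemma bernoulli_exp (R : realDomainType) (p : R) n :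
  0 <= p <= 1 -> (1 - p) ^+ n * (1 + p * n%:R) <= 1.
Proof.
move=> /andP[p0 p1]; elim: n => [|n IHn]; first by rewrite mulr0 addr0 mulr1.
have q0 : 0 <= (1 - p) ^+ n by rewrite exprn_ge0 // subr_ge0.
apply: le_trans IHn; rewrite exprSr -mulrA ler_wpM2l //.
have n0 : (0 : R) <= n%:R by [].
rewrite -natr1; nra.
Qed.

Section Potential.
Variables (R : realFieldType) (K : nat) (b : R) (S U : finType).
Variables (mem : S -> U -> bool) (OPT : {set S}) (L eps : R).
Hypothesis b_ge1 : 1 <= b.
Hypothesis L_ge0 : 0 <= L.
Hypothesis eps_ge0 : 0 <= eps.
(** The excess of one phase, [eps] for each of K+1 levels with weight at most b^(K+1), fits into the
    summand 2 of [budget]. *)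
Hypothesis eps_small : K.+1%:R * eps * b ^+ K.+1 <= 2.
Hypothesis decay : forall (q : R) n,
  0 <= q <= 1 -> L < q * n%:R -> (1 - q) ^+ n <= eps.
Hypothesis deg_set : forall s, #|[set u | mem s u]|%:R <= b ^+ K.
Hypothesis deg_elem : forall u, #|[set s | mem s u]|%:R <= b ^+ K.
Hypothesis OPT_cover : is_cover mem OPT.

Local Notation global := (global S U).
Implicit Types (g : global) (c : {ffun node S U -> 'I_K.+1}).
Local Notation pr := (rate K b).

Definition span g s : nat := #|[set u in uncov g | mem s u]|.

Definition freq g u : nat := #|[set s in eligible g | mem s u]|.

(* [s] has dropped out although it still has many uncovered elements. *)
Definition bad g s : bool :=
  (s \notin eligible g) && (L < pr (phase (now g)) * (span g s)%:R).

(** The factor 1 + b bounds p f + b at level 0, and b is the step from q to the next phase's b q. *)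
Definition budget : R := (1 + b) * b * (L + 2).

(* Share of [s] in the cost of all phases after the current one, the bracket
   bounding the share of the next phase: [L / q] elements that may stay
   uncovered, and all of them with the probability that [s] is bad at the end. *)
Definition reserve g s : R :=
  (K.+1 - phase (now g))%:R * budget +
  (1 + b) * b * (L + b ^+ phase (now g) *
    ((bad g s)%:R + (K.+1 - (level (now g) + joining (now g)))%:R * eps)).

(* Bounds the expected number of sets joining during the rest of the phase. *)
Definition live_cost g : R :=
  if joining (now g) then
    pr (level (now g)) * #|cands g|%:R +
    pr (phase (now g)) * b * #|uncov g|%:R
  else
    pr (phase (now g)) *
    \sum_(u in uncov g) (pr (level (now g)) * (freq g u)%:R + b).

Definition potential g : R :=
  #|joined g|%:R + live_cost g + \sum_(s in OPT) reserve g s.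

Let b_ge0 : 0 <= b. Proof. exact: le_trans ler01 b_ge1. Qed.
Let rate0 i : 0 <= pr i. Proof. exact: rate_ge0. Qed.

Lemma budget_ge0 : 0 <= budget.
Proof. by rewrite /budget ?(mulr_ge0, addr_ge0). Qed.

Lemma reserve_ge0 g s : 0 <= reserve g s.
Proof.
rewrite /reserve addr_ge0 ?mulr_ge0 ?budget_ge0 ?addr_ge0 //.
by rewrite mulr_ge0 ?exprn_ge0 ?addr_ge0 ?mulr_ge0.
Qed.

Lemma potential_ge_joined g : #|joined g|%:R <= potential g.
Proof.
rewrite /potential -addrA lerDl addr_ge0 //; last first.
  by apply: sumr_ge0 => s _; apply: reserve_ge0.
rewrite /live_cost; case: ifP => _; first by rewrite addr_ge0 // mulr_ge0 // mulr_ge0.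
rewrite mulr_ge0 //; apply: sumr_ge0 => u _.
by rewrite addr_ge0 // mulr_ge0.
Qed.

(** Every uncovered element lies in some optimal set; this transfers costs from elements to
    [OPT]. *)
Lemma uncov_le_span g : #|uncov g|%:R <= \sum_(s in OPT) (span g s)%:R :> R.
Proof.
rewrite -sum1_card natr_sum.
under [leRHS]eq_bigr do rewrite natr_card_sep.
rewrite exchange_big /=; apply: ler_sum => u _.
have [s Os smu] := OPT_cover u.
by rewrite (bigD1 s) //= smu lerDl sumr_ge0.
Qed.

(** * First slot of a level: elements beep *)

Lemma expect_hearing g : (phase (now g) <= K)%N ->
  expect b (fun c => #|hearing mem g c|%:R) <=
    pr (phase (now g)) * \sum_(u in uncov g) (freq g u)%:R.
Proof.
move=> leiK; set q := pr _.
(* Union bound: each surviving set is charged to all its beeping elements, and the double sum is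
   then regrouped by element. *)
pose X c := \sum_(s in eligible g) \sum_(u in uncov g | mem s u)
              (c (inr u) <= phase (now g))%N%:R : R.
apply: (@le_trans _ _ (expect b X)).
  apply: ler_expect => // c; rewrite natr_card_sep; apply: ler_sum => s _.
  case: existsP => [[u /and3P[Nu smu cu]]|_] /=; last exact: sumr_ge0.
  by rewrite (bigD1 u) ?Nu //= cu lerDl sumr_ge0.
rewrite /X expect_sum; under eq_bigr do rewrite expect_sum.
under eq_bigr do under eq_bigr do rewrite expect_below //.
rewrite mulr_sumr (exchange_big_dep [in uncov g]) /=; last first.
  by move=> s u _ /andP[].
apply: ler_sum => u Nu; rewrite natr_card_sep mulr_sumr.
rewrite [leRHS](bigID (fun s => mem s u)) /= [X in _ + X]big1 ?addr0.
  rewrite le_eqVlt; apply/orP; left; apply/eqP/eq_big => [s|s /and3P[_ _ ->]]; last by rewrite mulr1.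
  by rewrite Nu.
by move=> s /andP[_ /negPf->]; rewrite mulr0.
Qed.

(** A set turns bad only if it is heavy and all its uncovered elements stay silent. This has
    probability at most [eps], paid by the one [eps] that the level releases. *)
Lemma expect_reserve_hearing g s :
  ~~ joining (now g) -> (phase (now g) <= K)%N -> (level (now g) <= K)%N ->
  expect b (fun c => reserve (gstep mem g c) s) <= reserve g s.
Proof.
case: g => -[i j []] C J N //= _ leiK lejK.
set g := Global _ _ _ _.
pose heavy := L < pr i * (span g s)%:R.
pose A : {set node S U} := [set inr u | u in [set u in N | mem s u]].
have badS c : ((bad (gstep mem g c) s)%:R : R) <=
    (bad g s)%:R + heavy%:R * [forall v in A, (i < c v)%N]%:R.
  rewrite /bad /gstep /= -/(span g s) -/heavy {1}/eligible /= andbF inE.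
  case: heavy; rewrite ?andbF ?mul0r ?addr0 // !andbT mul1r -natrD ler_nat.
  case: (s \in eligible g) => //=; rewrite add0n.
  case: existsP => //= nex; rewrite lt0b; apply/forall_inP => v /imsetP[u].
  rewrite inE => /andP[Nu smu] ->; rewrite ltnNge; apply/negP => cu.
  by apply: nex; exists u; rewrite Nu smu.
have heavyE : heavy%:R * (1 - pr i) ^+ #|A| <= eps.
  rewrite card_imset; last by move=> ? ? [].
  rewrite /heavy; case: ltP => [hv|_]; rewrite ?mul0r ?mul1r //.
  by apply: decay => //; rewrite rate0 rate_le1.
set a := (K.+1 - i)%:R * budget; set M := (1 + b) * b.
have M0 : 0 <= M by rewrite /M mulr_ge0 ?addr_ge0.
apply: (@le_trans _ _ (expect b (fun c => (a + M * (L + b ^+ i *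
    ((bad g s)%:R + (K.+1 - j.+1)%:R * eps))) +
    M * b ^+ i * heavy%:R * [forall v in A, (i < c v)%N]%:R))).
  apply: ler_expect => // c; rewrite {1}/reserve /= -/a -/M addn1.
  have := ler_wpM2l (mulr_ge0 M0 (exprn_ge0 i b_ge0)) (badS c); lra.
rewrite expectD expect_cst // expectZ expect_all_above //.
rewrite /reserve /= -/a -/M addn0.
have -> : (K.+1 - j = (K.+1 - j.+1).+1)%N by lia.
have := ler_wpM2l (mulr_ge0 M0 (exprn_ge0 i b_ge0)) heavyE.
rewrite -natr1 -!mulrA; lra.
Qed.

(** The term q p f of each element pays for the expected number of surviving candidates, each of
    which costs p; the term q b is kept. *)
Lemma potential_hearing g :
  ~~ joining (now g) -> (phase (now g) <= K)%N -> (level (now g) <= K)%N ->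
  expect b (fun c => potential (gstep mem g c)) <= potential g.
Proof.
move=> gj leiK lejK.
have Eh := expect_hearing leiK.
have Er : expect b (fun c => \sum_(s in OPT) reserve (gstep mem g c) s) <=
    \sum_(s in OPT) reserve g s.
  by rewrite expect_sum; apply: ler_sum => s _; apply: expect_reserve_hearing.
case: g gj leiK lejK Eh Er => -[i j []] C J N //= _ leiK lejK.
set g := Global _ _ _ _ => Eh Er.
have -> : expect b (fun c => potential (gstep mem g c)) =
  expect b (fun c => ((#|J|%:R + pr i * b * #|N|%:R) +
     pr j * #|hearing mem g c|%:R) +
     \sum_(s in OPT) reserve (gstep mem g c) s).
  apply: eq_expect => c; rewrite {1}/potential /live_cost /=; congr (_ + _); ring.
rewrite expectD expectD expect_cst // expectZ /potential.
apply: lerD => //; rewrite -addrA lerD2l /live_cost /=.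
rewrite big_split /= sumr_const -mulr_sumr mulrDr -[b *+ _]mulr_natr.
rewrite [pr i * (b * _)]mulrA addrC lerD2r.
by rewrite mulrCA ler_wpM2l.
Qed.

(** * Second slot of a level: candidates join *)

Lemma span_le_deg g s : (span g s)%:R <= b ^+ K.
Proof.
apply: le_trans (deg_set s); rewrite ler_nat; apply: subset_leq_card.
by apply/subsetP=> u; rewrite !inE => /andP[].
Qed.

Lemma freq_le_deg g u : (freq g u)%:R <= b ^+ K.
Proof.
apply: le_trans (deg_elem u); rewrite ler_nat; apply: subset_leq_card.
by apply/subsetP=> s; rewrite !inE => /andP[].
Qed.

Lemma span_joining g c s :
  joining (now g) -> (span (gstep mem g c) s <= span g s)%N.
Proof.
move=> jg; rewrite /span /gstep jg /=; apply/subset_leq_card/subsetP => u.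
by rewrite !inE => /andP[/andP[-> _] ->].
Qed.

Lemma expect_joined g : joining (now g) -> (level (now g) <= K)%N ->
  expect b (fun c => #|joined (gstep mem g c)|%:R) <=
    #|joined g|%:R + pr (level (now g)) * #|cands g|%:R.
Proof.
move=> jg lejK.
apply: (@le_trans _ _ (expect b (fun c => #|joined g|%:R +
  \sum_(s in cands g) (c (inl s) <= level (now g))%N%:R))).
  apply: ler_expect => // c; rewrite /gstep jg /= -natr_card_sep -natrD ler_nat.
  by rewrite cardsU leq_subr.
rewrite expectD expect_cst // expect_sum lerD2l.
under eq_bigr do rewrite expect_below //.
by rewrite sumr_const mulr_natr.
Qed.

Lemma expect_missed g u : joining (now g) -> (level (now g) <= K)%N ->
  expect b (fun c => [forall s in cands g,
      mem s u ==> (level (now g) < c (inl s))%N]%:R) =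
    (1 - pr (level (now g))) ^+ freq g u.
Proof.
move=> jg lejK.
pose A : {set node S U} := [set inl s | s in [set s in cands g | mem s u]].
have -> : freq g u = #|A|.
  by rewrite card_imset ?/freq ?/eligible ?jg ?andbF // => ? ? [].
rewrite -expect_all_above //; apply: eq_expect => c; congr (nat_of_bool _)%:R.
apply/forall_inP/forall_inP => [allc v /imsetP[s]|allc s Cs].
  by rewrite inE => /andP[Cs smu] ->; have := allc s Cs; rewrite smu.
by apply/implyP => smu; apply/allc/imset_f; rewrite inE Cs smu.
Qed.

(** The joins cost p per candidate. At the next level p becomes b p, so an element that stays
    uncovered costs q b (1 + p f); this happens with probability (1 - p)^f, and [bernoulli_exp]
    bounds the expectation by q b. *)
Lemma potential_joining_next g :
  joining (now g) -> (phase (now g) <= K)%N -> (level (now g) < K)%N ->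
  expect b (fun c => potential (gstep mem g c)) <= potential g.
Proof.
move=> jg leiK ltjK.
have Ej := expect_joined jg (ltnW ltjK).
have Em := expect_missed _ jg (ltnW ltjK).
have njK := ltn_eqF ltjK.
(* Eligibility and the number of pending [eps] terms are unchanged, and spans only shrink. *)
have Hr c s : reserve (gstep mem g c) s <= reserve g s.
  rewrite /reserve now_gstep /tick jg njK /= addn0 addn1 lerD2l.
  rewrite ler_wpM2l ?mulr_ge0 ?addr_ge0 // lerD2l ler_wpM2l ?exprn_ge0 //.
  rewrite lerD2r ler_nat /bad now_gstep /tick jg njK /=.
  have -> : eligible (gstep mem g c) = eligible g.
    by rewrite /eligible now_gstep /tick jg njK /= /gstep jg andbF.
  case: (s \in _) => //=; case: ltP => //= heavy; rewrite lt0b.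
  apply: lt_le_trans heavy _.
  by rewrite ler_wpM2l // ler_nat span_joining.
pose X c (u : U) : R := (b * (1 + pr (level (now g)) * (freq g u)%:R)) *
  [forall s in cands g, mem s u ==> (level (now g) < c (inl s))%N]%:R.
apply: (@le_trans _ _ (expect b (fun c => (#|joined (gstep mem g c)|%:R +
    pr (phase (now g)) * \sum_(u in uncov g) X c u) + \sum_(s in OPT) reserve g s))).
  apply: ler_expect => // c; apply: lerD; last by apply: ler_sum => s _.
  rewrite lerD2l /live_cost now_gstep /tick jg njK /= ler_wpM2l //.
  rewrite {1}/gstep jg /missed sum_sep; apply: ler_sum => u Nu.
  rewrite /X ler_wpM2r // rateS.
  have -> : freq (gstep mem g c) u = freq g u.
    by rewrite /freq /eligible now_gstep /tick jg njK /= /gstep jg andbF.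
  lra.
rewrite expectD expectD expectZ expect_cst // lerD2r /live_cost jg addrA.
apply: lerD => //; rewrite -mulrA ler_wpM2l // expect_sum mulr_natr.
rewrite -sumr_const; apply: ler_sum => u Nu.
rewrite /X expectZ Em mulrAC -mulrA ger_pMr ?(lt_le_trans ltr01) //.
by rewrite bernoulli_exp // rate0 rate_le1 // ltnW.
Qed.

(** Now p = 1 and all candidates join, so a set with uncovered elements is bad or has q times its
    span at most L. The bracket of [reserve] pays for the next phase, and one released [budget]
    refills the bracket. *)
Lemma potential_joining_last g :
  joining (now g) -> (phase (now g) <= K)%N -> level (now g) = K ->
  expect b (fun c => potential (gstep mem g c)) <= potential g.
Proof.
move=> jg leiK jK.
have Ej := expect_joined jg (eq_leq jK).
have now' c : now (gstep mem g c) = Clock (phase (now g)).+1 0 false.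
  by rewrite now_gstep /tick jg jK eqxx.
have elig' c : eligible (gstep mem g c) = setT.
  by rewrite /eligible now'.
have b1_ge0 : 0 <= 1 + b by rewrite addr_ge0.
set i := phase (now g) in leiK now'.
have live' c : live_cost (gstep mem g c) <=
    (1 + b) * b * \sum_(s in OPT) pr i * (span (gstep mem g c) s)%:R.
  rewrite /live_cost now' /=.
  apply: (@le_trans _ _ (pr i.+1 * ((1 + b) * #|uncov (gstep mem g c)|%:R))).
    rewrite ler_wpM2l // mulr_natr -sumr_const; apply: ler_sum => u _.
    rewrite lerD2r /rate expr0 mul1r mulrC ler_pdivrMr ?mul1r ?freq_le_deg //.
    by rewrite exprn_gt0 // (lt_le_trans ltr01).
  have -> : pr i.+1 * ((1 + b) * #|uncov (gstep mem g c)|%:R) =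
      (1 + b) * b * (pr i * #|uncov (gstep mem g c)|%:R) by rewrite rateS; ring.
  by rewrite ler_wpM2l ?mulr_ge0 // -mulr_sumr ler_wpM2l // uncov_le_span.
have span' c s : pr i * (span (gstep mem g c) s)%:R <=
    L + b ^+ i * (bad g s)%:R.
  have [Cs|nCs] := boolP (s \in cands g).
    have -> : span (gstep mem g c) s = 0%N.
      apply/eqP; rewrite cards_eq0; apply/eqP/setP => u.
      rewrite !inE /gstep jg /= !inE; apply/negP => /andP[/andP[_]].
      by move=> /forall_inP/(_ s Cs)/implyP miss /miss; rewrite jK ltnNge -ltnS ltn_ord.
    by rewrite mulr0 addr_ge0 // mulr_ge0 // exprn_ge0.
  rewrite /bad /eligible jg andbF nCs -/i /=.
  case: ltP => [_|light]; last first.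
    rewrite mulr0 addr0; apply: le_trans light.
    by rewrite ler_wpM2l // ler_nat span_joining.
  (* For a bad set the degree bound b^K suffices: q b^K = b^i. *)
  rewrite mulr1 (le_trans (ler_wpM2l _ (span_le_deg _ _))) // /rate.
  by rewrite divfK ?lerDr // expf_neq0 // gt_eqF // (lt_le_trans ltr01).
have budgetS : (1 + b) * b * (L + b ^+ i.+1 * (K.+1%:R * eps)) <= budget.
  rewrite ler_wpM2l ?mulr_ge0 // lerD2l (le_trans _ eps_small) //.
  by rewrite mulrC ler_wpM2l ?mulr_ge0 // ler_weXn2l.
have reserve' c s : (1 + b) * b * (pr i * (span (gstep mem g c) s)%:R) +
    reserve (gstep mem g c) s <= reserve g s.
  rewrite /reserve {1}/bad now' elig' inE /= add0r add0n subn0 jg jK addn1 subnn.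
  rewrite mul0r addr0 subSS -/i.
  have -> : (K.+1 - i = (K - i).+1)%N by lia.
  have := ler_wpM2l (mulr_ge0 b1_ge0 b_ge0) (span' c s).
  by move: budgetS; rewrite -natr1; lra.
apply: (@le_trans _ _ (expect b (fun c => #|joined (gstep mem g c)|%:R +
    \sum_(s in OPT) reserve g s))).
  apply: ler_expect => // c; rewrite /potential -addrA lerD2l.
  apply: le_trans (lerD (live' c) (lexx _)) _.
  rewrite mulr_sumr -big_split; apply: ler_sum => s _; exact: reserve'.
rewrite expectD expect_cst // lerD2r (le_trans Ej) // lerD2l /live_cost jg.
by rewrite lerDl mulr_ge0 // mulr_ge0.
Qed.

Lemma potential_gstep g : (phase (now g) <= K)%N -> (level (now g) <= K)%N ->
  expect b (fun c => potential (gstep mem g c)) <= potential g.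
Proof.
move=> leiK lejK; have [jg|njg] := boolP (joining (now g)); last first.
  exact: potential_hearing.
move: lejK; rewrite leq_eqVlt => /orP[/eqP|]; first exact: potential_joining_last.
exact: potential_joining_next.
Qed.

(** The live cost is at most b^(-K) (1 + b) |U|, and |U| is at most b^K |OPT|. Each optimal set
    reserves K+1 budgets and a bracket worth one more. *)
Lemma potential_ginit :
  potential (@ginit S U) <= #|OPT|%:R * ((1 + b) + K.+2%:R * budget).
Proof.
have b1_ge0 : 0 <= 1 + b by rewrite addr_ge0.
have bK_gt0 : 0 < b ^+ K by rewrite exprn_gt0 // (lt_le_trans ltr01).
rewrite /potential /live_cost /= cards0 add0r mulrDr lerD //.
  apply: (@le_trans _ _ (pr 0 * ((1 + b) * #|[set: U]|%:R))).
    rewrite ler_wpM2l // mulr_natr -sumr_const; apply: ler_sum => u _.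
    rewrite lerD2r /rate expr0 mul1r mulrC ler_pdivrMr //.
    by rewrite mul1r freq_le_deg.
  rewrite mulrCA mulrC ler_wpM2r // /rate expr0 mul1r mulrC ler_pdivrMr //.
  apply: le_trans (uncov_le_span (@ginit S U)) _.
  rewrite mulrC mulr_natr -sumr_const; apply: ler_sum => s _.
  exact: span_le_deg.
rewrite mulrC mulr_natr -sumr_const; apply: ler_sum => s _.
rewrite /reserve /bad /eligible /= inE /= add0r !subn0 -[K.+2%:R]natr1 [leRHS]mulrDl mul1r.
rewrite lerD2l expr0 mul1r ler_wpM2l ?mulr_ge0 // lerD2l (le_trans _ eps_small) //.
by rewrite ler_peMr ?mulr_ge0 // exprn_ege1.
Qed.

Lemma expected_joined :
  \sum_(om : {ffun 'I_(2 * (K.+1 * K.+1)) -> {ffun node S U -> 'I_K.+1}})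
     (\prod_i weight b (om i)) * #|joined (grun mem om)|%:R <=
  #|OPT|%:R * ((1 + b) + K.+2%:R * budget).
Proof.
apply: le_trans potential_ginit.
(* Tying the remaining steps to the clock yields [phase <= K] as long as a step remains. *)
pose inv n g := (level (now g) <= K)%N /\
  (slot K (now g) + n = 2 * (K.+1 * K.+1))%N.
have decr n g : inv n.+1 g ->
    expect b (fun c => potential (gstep mem g c)) <= potential g.
  move=> [lejK slotE]; apply: potential_gstep => //.
  by move: slotE; rewrite /slot leqNgt; case: ltnP => //; nia.
have invS n g c : inv n.+1 g -> inv n (gstep mem g c).
  move=> [lejK slotE]; split; rewrite now_gstep; first exact: level_tick.
  by rewrite slot_tick addSnnS.
have inv0 : inv (2 * (K.+1 * K.+1))%N (@ginit S U) by [].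
apply: le_trans (supermartingale_bound (@weight_ge0 _ K b b_ge1 _) invS decr inv0).
apply: ler_sum => om _; rewrite ler_wpM2l ?potential_ge_joined //.
by apply: prodr_ge0 => i _; apply: weight_ge0.
Qed.

End Potential.

(** * Choice of the parameters *)

Section Degrees.
Variables (S U : finType) (mem : S -> U -> bool).

Lemma card_set_le_maxdeg s : (#|[set u | mem s u]| <= maxdeg mem)%N.
Proof.
apply: leq_trans _ (@leq_bigmax _ (deg mem) (inl s)).
have inj : injective (@inr S U) by move=> ? ? [].
rewrite -(card_imset _ inj).
by apply/subset_leq_card/subsetP => v /imsetP[u + ->]; rewrite !inE.
Qed.

Lemma card_elem_le_maxdeg u : (#|[set s | mem s u]| <= maxdeg mem)%N.
Proof.
apply: leq_trans _ (@leq_bigmax _ (deg mem) (inr u)).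
have inj : injective (@inl S U) by move=> ? ? [].
rewrite -(card_imset _ inj).
by apply/subset_leq_card/subsetP => v /imsetP[s + ->]; rewrite !inE.
Qed.

End Degrees.

Lemma exp_gt0 (x : R) : 0 < exp x.
Proof. exact/RltP/exp_pos. Qed.

Lemma ler_exp (x y : R) : x <= y -> exp x <= exp y.
Proof.
rewrite le_eqVlt => /orP[/eqP->//|/RltP ltxy].
exact/ltW/RltP/exp_increasing.
Qed.

Lemma ler_ln (x y : R) : 0 < x -> x <= y -> ln x <= ln y.
Proof.
move=> /RltP x0; rewrite le_eqVlt => /orP[/eqP->//|/RltP ltxy].
exact/ltW/RltP/ln_increasing.
Qed.

Lemma exprB1_le_exp (q l : R) n :
  0 <= q <= 1 -> l < q * n%:R -> (1 - q) ^+ n <= exp (- l)%R.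
Proof.
move=> /andP[q0 q1] lql; apply: (@le_trans _ _ (exp (- q)%R ^+ n)).
  apply: lerXn2r; rewrite ?nnegrE ?subr_ge0 ?(ltW (exp_gt0 _)) //.
  exact/RleP/exp_ineq1_le.
by rewrite expRX ler_exp // -mulr_natr mulNr lerN2 ltW.
Qed.

Lemma ln2_ge_half : 1 <= 2 * ln 2%R.
Proof.
have e2 : IZR 2 = 2%R by rewrite IZRposE INRE.
have /RltP := ln_lt_2; rewrite RinvE e2; lra.
Qed.

Lemma ln_natX2 n : ln (2 ^ n)%:R%R = ln 2%R *+ n.
Proof.
have e2 : exp (ln 2%R) = 2 by apply/exp_ln/RltP/(ltr0Sn R 1).
by rewrite natrX -[X in X ^+ n]e2 expRX ln_exp.
Qed.

(** K is a factor of the approximation ratio, hence the logarithmic cap. *)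
Definition num_phases (Delta k : nat) : nat := minn k (up_log 2 Delta).

(** The maximum makes the bound 1 <= b, which [cover_alg] demands, hold for all parameters. *)
Definition growth (Delta k : nat) : R :=
  Num.max 1 (exp (ln (INR Delta) / (num_phases Delta k)%:R)%R).

Lemma growth_ge1 Delta k : 1 <= growth Delta k.
Proof. by rewrite le_max lexx. Qed.

Definition setcover_alg (Delta k : nat) : beep_alg :=
  cover_alg (num_phases Delta k) (growth_ge1 Delta k).

Section Numerics.
Variables (Delta k : nat).
Hypotheses (k_gt0 : (0 < k)%N) (Delta_gt1 : (1 < Delta)%N).

Local Notation K := (num_phases Delta k).
Local Notation b := (growth Delta k).
Local Notation l := (ln (INR Delta)).

Lemma num_phases_gt0 : (0 < K)%N.
Proof. by rewrite leq_min k_gt0 up_log_gt0. Qed.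

Lemma ln_Delta_ge : 1 <= 2 * l.
Proof.
apply: le_trans ln2_ge_half _.
by rewrite ler_wpM2l // INRE ler_ln // ler_nat.
Qed.

Lemma ln_Delta_ge0 : 0 <= l.
Proof. have := ln_Delta_ge; lra. Qed.

Lemma exp_ln_Delta : exp l = Delta%:R.
Proof. by rewrite INRE exp_ln //; apply/RltP; rewrite ltr0n ltnW. Qed.

Lemma growthX : b ^+ K = Delta%:R.
Proof.
have K0 := num_phases_gt0; have l0 := ln_Delta_ge.
have -> : b = exp (l / K%:R)%R.
  rewrite /growth max_r // -[leLHS]expR0 ler_exp // divr_ge0 //; exact: ln_Delta_ge0.
by rewrite expRX -[X in exp X]mulr_natr divfK ?exp_ln_Delta // pnatr_eq0 -lt0n.
Qed.

(** Either K = k and b = Delta^(1/k), or K is the rounded-up binary logarithm and b^K = Delta <= 2^K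
    gives b <= 2. *)
Lemma growth_le : b <= 2 * Rpower (INR Delta) (1 / INR k).
Proof.
have l0 := ln_Delta_ge.
set B := Rpower _ _.
have BE : B = exp (l / k%:R)%R.
  by rewrite /B /Rpower RmultE RdivE mul1r mulrC !INRE.
have B1 : 1 <= B by rewrite BE -[leLHS]expR0 ler_exp // divr_ge0 //; exact: ln_Delta_ge0.
have [leku|/ltnW leuk] := leqP k (up_log 2 Delta).
  have KE : K = k by apply/minn_idPl.
  by rewrite /growth KE -BE max_r //; lra.
have KE : K = up_log 2 Delta by apply/minn_idPr.
suff : b <= 2 by lra.
have K0 := num_phases_gt0.
rewrite -(ler_pXn2r K0) ?nnegrE ?(le_trans _ (growth_ge1 _ _)) //.
by rewrite growthX -natrX ler_nat KE up_logP.
Qed.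

Lemma num_phases_le_ln : K%:R <= 4 * l.
Proof.
have l0 := ln_Delta_ge.
set n := up_log 2 Delta.
have n0 : (0 < n)%N by rewrite up_log_gt0.
have leKn : K%:R <= n%:R :> R by rewrite ler_nat geq_minr.
have : n.-1%:R * ln 2%R <= l.
  rewrite mulr_natl -ln_natX2 INRE ler_ln ?ltr0n ?expn_gt0 // ler_nat ltnW //.
  exact: up_log_gtn.
have nE : n%:R = n.-1%:R + 1 :> R by rewrite natr1 prednK.
have : 0 <= n.-1%:R :> R by [].
move: l0 ln2_ge_half leKn; rewrite nE.
set m := n.-1%:R; set a := ln 2%R; nra.
Qed.

(** The choice L = 3 ln Delta gives Delta^(-3), which absorbs K+1 <= 2 Delta, b <= Delta and b^K =
    Delta. *)
Lemma num_phases_small :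
  K.+1%:R * exp (- (3 * l))%R * b ^+ K.+1 <= 2.
Proof.
have D0 : 0 < Delta%:R :> R by rewrite ltr0n ltnW.
have bD : b <= Delta%:R.
  rewrite -growthX -[leLHS]expr1 ler_weXn2l ?growth_ge1 //; exact: num_phases_gt0.
have KD : K.+1%:R <= 2 * Delta%:R :> R.
  rewrite -natrM ler_nat mul2n -addnn -addn1 leq_add ?(ltnW Delta_gt1) //.
  apply: leq_trans (geq_minr _ _) _; apply: up_log_min => //.
  exact/ltnW/ltn_expl.
have eE : exp (- (3 * l))%R * Delta%:R ^+ 3 = 1.
  by rewrite -exp_ln_Delta expRX expRD mulr_natl RplusE addNr expR0.
have e0 := exp_gt0 (- (3 * l))%R.
rewrite exprS growthX -[leRHS]mulr1 -[X in _ <= _ * X]eE.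
rewrite [leRHS](_ : _ = (2 * Delta%:R) * exp (- (3 * l))%R * (Delta%:R * Delta%:R));
  last by ring.
apply: ler_pM => //; first by rewrite mulr_ge0 // ltW.
- by rewrite mulr_ge0 ?(ltW D0) // (le_trans ler01) // growth_ge1.
- by rewrite ler_wpM2r // ltW.
- by rewrite ler_wpM2r // ltW.
Qed.

Lemma ratio_le :
  (1 + b) + K.+2%:R * budget b (3 * l) <=
    348 * l ^+ 2 * Rpower (INR Delta) (1 / INR k) ^+ 3.
Proof.
have l0 := ln_Delta_ge.
have Kl := num_phases_le_ln; have bB := growth_le; have b1 := growth_ge1 Delta k.
move: bB; set B := Rpower _ _ => bB.
have B1 : 1 <= B.
  rewrite /B /Rpower RmultE RdivE -[leLHS]expR0 ler_exp // mulr_ge0 ?divr_ge0 //.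
    by rewrite INRE.
  exact: ln_Delta_ge0.
have K0 : 0 <= K%:R :> R by [].
rewrite /budget -[K.+2%:R]natr1 -[K.+1%:R]natr1.
move: l0 Kl bB b1 K0; set x := l; set q := K%:R; set g := b => l0 Kl bB b1 K0.
have x1 : 1 <= 2 * x by lra.
have e1 : (1 + g) * g <= 6 * B ^+ 2 by rewrite expr2; nra.
have e2 : (q + 1 + 1) * (3 * x + 2) <= 56 * x ^+ 2 by rewrite expr2; nra.
have e3 : (q + 1 + 1) * ((1 + g) * g * (3 * x + 2)) <= 336 * (x ^+ 2 * B ^+ 2).
  rewrite mulrCA (_ : 336 * _ = 6 * B ^+ 2 * (56 * x ^+ 2)); last by ring.
  by apply: ler_pM => //; nra.
have e4 : x ^+ 2 * B ^+ 2 <= x ^+ 2 * B ^+ 3.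
  by rewrite ler_wpM2l ?sqr_ge0 // ler_weXn2l.
have e5 : B <= 4 * (x ^+ 2 * B ^+ 3).
  rewrite -[leLHS]mul1r mulrA; apply: ler_pM => //; first lra.
    by rewrite expr2; nra.
  by rewrite -[leLHS]expr1 ler_weXn2l.
(* Since 1 + b <= 3 B, the total is 3 * 4 + 336 = 348. *)
rewrite -mulrA; lra.
Qed.

End Numerics.

(* alg Delta k : the algorithm run by the nodes, which know Delta and k. *)
Theorem theorem1 :
  exists (alg : nat -> nat -> beep_alg) (c_time : nat) (c_apx : R),
    (0 < c_apx)%R /\
    forall (k Delta : nat), (3 < k)%N -> (2 <= Delta)%N ->
      (rounds (alg Delta k) <= c_time * k ^ 3)%N /\
      forall (S U : finType) (mem : S -> U -> bool),
        maxdeg mem = Delta ->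
        (forall u : U, exists s : S, mem s u) ->
        always_covers (alg Delta k) mem /\
        forall C : {set S}, is_min_cover mem C ->
          (expected_size (alg Delta k) mem
           <= c_apx * (ln (INR Delta)) ^+ 2
                    * (Rpower (INR Delta) (1 / INR k)) ^+ 3
                    * (#|C|)%:R)%R.
Proof.
(* The time is 2(K+1)^2 <= 8 k^2; the ratio constant is that of [ratio_le]. *)
exists setcover_alg, 8%N, 348%:R; split=> [|k Delta k_gt3 Delta_gt1]; first by rewrite ltr0n.
have k_gt0 : (0 < k)%N by apply: leq_trans k_gt3.
split.
  rewrite /= /num_phases; set K := minn _ _.
  have : (K <= k)%N by apply: geq_minl.
  by rewrite !expnS expn0 muln1; nia.
move=> S U mem degE cov; split=> [om _|C [C_cover _]].
  by rewrite output_grun; apply: covers_grun.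
have e0 := exp_gt0 (- (3 * ln (INR Delta)))%R.
have l0 : 0 <= 3 * ln (INR Delta).
  by rewrite mulr_ge0 //; apply: ln_Delta_ge0.
apply: le_trans (ler_wpM2r (ler0n _ #|C|) (ratio_le k_gt0 Delta_gt1)).
rewrite [leRHS]mulrC; apply: le_trans _ (expected_joined
  (growth_ge1 Delta k) l0 (ltW e0) (num_phases_small k_gt0 Delta_gt1) _ _ _ C_cover).
- apply: ler_sum => om _; rewrite output_grun; exact: lexx.
- by move=> q n; apply: exprB1_le_exp.
- by move=> s; rewrite growthX // -degE ler_nat card_set_le_maxdeg.
- by move=> u; rewrite growthX // -degE ler_nat card_elem_le_maxdeg.
Qed.
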